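(* Let $(X,d)$ be a complete metric space and $(Y,\varrho)$ be a linear metric space with a translation-invariant metric. Let $\delta,\kappa,\hat\kappa,\ell$ be positive constants such that $\kappa\ell<1$ and $\hat\kappa>\kappa/(1-\kappa\ell)$, let $\mu,r\in(0,\infty]$, let $(\bar x,\bar z,\bar w)\in X\times Y\times Y$, and let $F,G:X\rightrightarrows Y$ be set-valued mappings with $\bar z\in F(\bar x)$ and $\bar w\in G(\bar x)$, such that the sum $H:=F+G$ has a closed graph. Put $\alpha:=\delta+\hat\kappa r$ and assume that: (i) $F$ is regular with the constant $\kappa$ on the set $$\big\{(x,y)\in B_X(\bar x,\alpha)\times B_Y(\bar z,\mu+\delta):\ \operatorname{dist}\big(y,F(x)\cap B_Y(\bar z,\mu+\delta+r)\big)<r\big\};$$ (ii) $G$ has Aubin property on $B_X(\bar x,\alpha)\times B_Y(\bar w,\mu)$ with the constant $\ell$; (iii) for each $x\in B_X(\bar x,\alpha)$ and each $v\in H(x)\cap B_Y(\bar z+\bar w,\delta+r)$ there is a $w\in G(x)\cap B_Y(\bar w,\mu)$ such that $v\in F(x)+w$. Then $H$ is regular on $\{(x,y)\in B_X(\bar x,\delta)\times B_Y(\bar z+\bar w,\delta):\ \operatorname{dist}(y,H(x))<r\}$ with the constant $\hat\kappa$.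
   Context: Vector spaces are real. $B_X[x,r]$ and $B_X(x,r)$ denote the closed and the open ball with center $x$ and radius $r$; for $r=\infty$ both equal the whole space (a closed ball of radius $0$ is the singleton of its center). For $F,G:X\rightrightarrows Y$: $F^{-1}(y)=\{x: y\in F(x)\}$, $(F+G)(x)=\{z+w: z\in F(x),\,w\in G(x)\}$; the graph of $H$ is $\{(x,y)\in X\times Y:y\in H(x)\}$. Convention: $\inf\emptyset=\infty$, so the distance of a point to the empty set is $\infty$. For $W\subset X\times Y$ and $\kappa>0$, $F$ is regular on $W$ with the constant $\kappa$ if $\operatorname{dist}(x,F^{-1}(y))\le\kappa\operatorname{dist}(y,F(x))$ for each $(x,y)\in W$. $G$ has Aubin property on $U\times V\subset X\times Y$ with the constant $\ell$ if $G(x)\cap V\subset G(u)+B_Y[0,\ell\,d(x,u)]$ for each $x,u\in U$. *)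

(* Defs.v *)
From HB Require Import structures.
From mathcomp Require Import all_boot all_order all_algebra.
From mathcomp Require Import all_classical all_reals topology ereal.
Set Implicit Arguments.
Unset Strict Implicit.
Unset Printing Implicit Defensive.
Import Order.TTheory GRing.Theory Num.Theory.

Local Open Scope classical_set_scope.
Local Open Scope ring_scope.

#[short(type="completeMetricType")]
HB.structure Definition CompleteMetric (R : numDomainType) :=
  {T of Complete T & Metric R T}.

(* [TopologicalLmodule] cannot be reused here: it is declared on top of
   [PseudoMetricNormedZmod], and HB refuses any join of [Metric] and
   [GRing.Lmodule] once the latter structure is loaded. For the same reason
   this file has to be compiled without the normedtype libraries; files using
   it may load them. *)
HB.structure Definition MetricLmodule (R : numDomainType) :=
  {T of GRing.Lmodule R T & Metric R T}.

HB.mixin Record MetricLmodule_isLinearMetric (R : numDomainType) T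
    & MetricLmodule R T := {
  metric_add_continuous : continuous (fun x : T * T => x.1 + x.2) ;
  metric_scale_continuous : continuous (fun z : R^o * T => z.1 *: z.2)
}.

(* The metric need not be translation invariant. *)
#[short(type="linearMetricType")]
HB.structure Definition LinearMetric (R : numDomainType) :=
  {T of MetricLmodule R T & MetricLmodule_isLinearMetric R T}.

Definition translation_invariant (R : numDomainType) (Y : linearMetricType R) :=
  forall x y z : Y, mdist (x + z) (y + z) = mdist x y.

Section Metric.
Context {R : realType} {X : metricType R}.

(* [ball] has real radii only. *)
Definition oball (x : X) (r : \bar R) : set X :=
  [set y | ((mdist x y)%:E < r)%E].

(* The library's [closed_ball] is the closure of [ball]: it can be smaller than
   this set, and it is empty for radius 0. *)
Definition cball (x : X) (r : \bar R) : set X :=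
  [set y | ((mdist x y)%:E <= r)%E].

(* Equals +oo when [A] is empty. *)
Definition dist_set (x : X) (A : set X) : \bar R :=
  ereal_inf [set (mdist x a)%:E | a in A].

End Metric.

Definition setadd {Y : zmodType} (A B : set Y) : set Y :=
  [set a + b | a in A & b in B].

Definition svadd {X : Type} {Y : zmodType} (F G : X -> set Y) : X -> set Y :=
  fun x => setadd (F x) (G x).

Definition svinv {X Y : Type} (F : X -> set Y) : Y -> set X :=
  fun y => [set x | F x y].

Definition svgraph {X Y : Type} (F : X -> set Y) : set (X * Y) :=
  [set xy | F xy.1 xy.2].

Definition regular_on {R : realType} {X Y : metricType R}
    (F : X -> set Y) (W : set (X * Y)) (kappa : R) : Prop :=
  forall x y, W (x, y) ->
    (dist_set x (svinv F y) <= kappa%:E * dist_set y (F x))%E.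

Definition aubin_on {R : realType} {X : metricType R} {Y : linearMetricType R}
    (G : X -> set Y) (U : set X) (V : set Y) (l : R) : Prop :=
  forall x u, U x -> U u ->
    G x `&` V `<=` setadd (G u) (cball 0 (l * mdist x u)%:E).

(* Main.v *)
Require Import Defs.
From HB Require Import structures.
From mathcomp Require Import all_boot all_order all_algebra.
From mathcomp Require Import all_classical all_reals topology ereal.
From mathcomp Require Import normedtype sequences ring lra.
Set Implicit Arguments.
Unset Strict Implicit.
Unset Printing Implicit Defensive.
Import Order.TTheory GRing.Theory Num.Theory.

Local Open Scope classical_set_scope.
Local Open Scope ring_scope.

(** A residual y - v of a point (u, v) of the graph of F + G can be shrunk as
  in Newton's method. Write v = z + w as in (iii); regularity of F moves u to
  some u' with y - w in F u', at distance < k d(y, v) for any k > kappa, and the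
  Aubin property replaces w by w' in G u' with d(w, w') <= l d(u, u'). The new
  point (u', y - w + w') has residual at most k l d(y, v). For
  k = hkappa / (1 + hkappa l) one has kappa < k, k l < 1 and
  k + hkappa (k l) = hkappa, so d(u, u') is at most the decrease of
  hkappa d(y, v): the iterates are Cauchy, stay in the ball of radius alpha, and
  converge to a solution within hkappa d(y, v) of the starting point. *)

(** The quantity [c * mdist y v] acts as a potential: each step pays for its move in [X] by a
    decrease of it, so all moves together cost at most its initial value. The factor [q] drives the
    residual to 0, which makes the second components converge to [y]. [P] need not be closed, hence
    the limit lies only in its closure. *)
Lemma metric_descent (R : realType) (X : completeMetricType R)
    (Y : metricType R) (P : set (X * Y)) (y : Y) (c q : R) :
  0 < c -> 0 <= q < 1 ->
  (forall x v, P (x, v) -> exists x' v', [/\ P (x', v'),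
     mdist x x' + c * mdist y v' <= c * mdist y v &
     mdist y v' <= q * mdist y v]) ->
  forall x v, P (x, v) ->
  exists2 x', closure P (x', y) & mdist x x' <= c * mdist y v.
Proof.
move=> c0 /andP[q0 q1] step x v Pxv.
have /choice[f fP] : forall p, exists p', P p -> [/\ P p',
    mdist p.1 p'.1 + c * mdist y p'.2 <= c * mdist y p.2 &
    mdist y p'.2 <= q * mdist y p.2].
  move=> [a b]; have [/step[a' [b' ?]]|?] := pselect (P (a, b)).
    by exists (a', b').
  by exists (a, b).
pose u n := iter n f (x, v).
have Pu n : P (u n) by elim: n => //= n /fP[].
have uq n : mdist y (u n).2 <= q ^+ n * mdist y v.
  elim: n => [|n IH]; first by rewrite expr0 mul1r.
  have [_ _] := fP _ (Pu n); move=> /le_trans; apply.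
  by rewrite exprS -mulrA ler_wpM2l.
have u_tele n m : mdist (u n).1 (u (n + m)%N).1 + c * mdist y (u (n + m)%N).2
    <= c * mdist y (u n).2.
  elim: m => [|m IH]; first by rewrite addn0 mdistxx add0r.
  have [_ + _] := fP _ (Pu (n + m)%N).
  rewrite addnS -[f _]/(u (n + m).+1).
  have := metric_triangle (u n).1 (u (n + m)%N).1 (u (n + m).+1).1.
  by lra.
have u2y : (fun n => (u n).2) @ \oo --> y.
  apply/cvg_ballP => e e0.
  have nq : `|q| < 1 by rewrite ger0_norm.
  have := @cvgMr_tmp _ _ _ eventually_filter _ _ (mdist y v) (cvg_expr nq).
  rewrite mul0r => /(@cvgr0_norm_lt _ R^o) /(_ e e0).
  apply: filterS => n /= h.
  rewrite ballEmdist /=.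
  by apply: le_lt_trans h; rewrite (le_trans (uq n)) ?ler_norm.
have /cvg_ex[x' u1x'] : cvg ((fun n => (u n).1) @ \oo).
  apply: cauchy_cvg; apply: cauchy_exP => e e0.
  (* Once the residual is below [e / c], the remaining potential is below [e], and [u_tele] bounds
     every later move by it. *)
  move/cvg_ballP : u2y => /(_ (e / c) (divr_gt0 e0 c0))[N _ /(_ N (leqnn N))].
  rewrite ballEmdist /= ltr_pdivlMr// mulrC => eN.
  exists (u N).1; exists N => // n /= /subnKC <-; rewrite ballEmdist /=.
  have := u_tele N (n - N)%N.
  have := mulr_ge0 (ltW c0) (mdist_ge0 y (u (N + (n - N))%N).2).
  by lra.
exists x'.
  apply: (@closed_cvg _ _ \oo _ u); first exact: closed_closure.
    by apply: nearW => n; apply: subset_closure.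
  rewrite [u](_ : _ = fun n => ((u n).1, (u n).2)); last first.
    by apply/funext => n; case: (u n).
  exact: cvg_pair.
apply/ler_addgt0Pr => e e0.
move/cvg_ballP : u1x' => /(_ e e0)[N _ /(_ N (leqnn N))].
rewrite ballEmdist /= metric_sym => eN.
have := metric_triangle x (u N).1 x'.
have := u_tele 0%N N; rewrite /= add0n.
have := mulr_ge0 (ltW c0) (mdist_ge0 y (u N).2).
by lra.
Qed.

Lemma oballD (R : realType) (X : metricType R) (a b : \bar R) (x y z : X) :
  oball x a y -> oball y b z -> oball x (a + b)%E z.
Proof.
rewrite /oball /= => xy yz; apply: le_lt_trans (lteD xy yz).
by rewrite -EFinD lee_fin metric_triangle.
Qed.

Lemma oball_sym (R : realType) (X : metricType R) (a : \bar R) (x y : X) :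
  oball x a y -> oball y a x.
Proof. by rewrite /oball /= metric_sym. Qed.

Lemma dist_set_le (R : realType) (X : metricType R) (A : set X) (x a : X) :
  A a -> (dist_set x A <= (mdist x a)%:E)%E.
Proof. by move=> Aa; apply: ereal_inf_lbound; exists a. Qed.

Theorem theorem3p10 (R : realType) (X : completeMetricType R)
    (Y : linearMetricType R) (Y_inv : translation_invariant Y)
    (delta kappa hkappa l : R)
    (delta_gt0 : 0 < delta) (kappa_gt0 : 0 < kappa)
    (hkappa_gt0 : 0 < hkappa) (l_gt0 : 0 < l)
    (kappal_lt1 : kappa * l < 1)
    (hkappa_gt : kappa / (1 - kappa * l) < hkappa)
    (mu r : \bar R) (mu_gt0 : (0 < mu)%E) (r_gt0 : (0 < r)%E)
    (xb : X) (zb wb : Y) (F G : X -> set Y)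
    (Fzb : F xb zb) (Gwb : G xb wb) :
  let H := svadd F G in
  let alpha := (delta%:E + hkappa%:E * r)%E in
  closed (svgraph H) ->
  regular_on F
    [set xy : X * Y | [/\ oball xb alpha xy.1,
       oball zb (mu + delta%:E)%E xy.2 &
       (dist_set xy.2 (F xy.1 `&` oball zb (mu + delta%:E + r)%E) < r)%E]]
    kappa ->
  aubin_on G (oball xb alpha) (oball wb mu) l ->
  (forall (x : X) (v : Y), oball xb alpha x ->
     (H x `&` oball (zb + wb) (delta%:E + r)%E) v ->
     exists2 w : Y, (G x `&` oball wb mu) w & [set z + w | z in F x] v) ->
  regular_on H
    [set xy : X * Y | [/\ oball xb delta%:E xy.1,
       oball (zb + wb) delta%:E xy.2 & (dist_set xy.2 (H xy.1) < r)%E]]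
    hkappa.
Proof.
move=> H alpha clH regF aubG sumG x y [/= xin yin dr].
have distB (a b c : Y) : mdist (a - c) b = mdist a (b + c).
  by rewrite -(Y_inv (a - c) b c) subrK.
have hl_gt0 : 0 < 1 + hkappa * l by rewrite addr_gt0 ?mulr_gt0.
pose k := hkappa / (1 + hkappa * l).
have kE : k + hkappa * (k * l) = hkappa.
  by rewrite /k; field; rewrite gt_eqF.
have k_gt0 : 0 < k by rewrite divr_gt0.
have kappa_lt : kappa < k.
  rewrite /k ltr_pdivlMr//.
  by move: hkappa_gt; rewrite ltr_pdivrMr ?subr_gt0//; lra.
have kl_lt1 : k * l < 1 by rewrite /k mulrAC ltr_pdivrMr//; lra.
(* The middle condition adds the distance from [xb] to the potential still to be spent. By the
   triangle inequality this sum never grows along a step, so no iterate leaves the ball of radius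
   [alpha]. *)
pose P := [set p : X * Y | [/\ H p.1 p.2,
  ((mdist xb p.1 + hkappa * mdist y p.2)%:E < alpha)%E & oball y r p.2]].
have step u v : P (u, v) -> exists u' v', [/\ P (u', v'),
    mdist u u' + hkappa * mdist y v' <= hkappa * mdist y v &
    mdist y v' <= k * l * mdist y v].
  move=> Puv; have [/= Huv uv_alpha yv] := Puv.
  have [yvE|v_neq_y] := eqVneq y v.
    by exists u, v; rewrite -yvE !mdistxx !mulr0 addr0 {1}yvE.
  have yv_gt0 : 0 < mdist y v by rewrite mdist_gt0.
  have u_in : oball xb alpha u.
    apply: le_lt_trans uv_alpha; rewrite lee_fin lerDl.
    by rewrite mulr_ge0 ?mdist_ge0 ?ltW.
  have [w [Gw w_in] [z Fz zwE]] := sumG u v u_in (conj Huv (oballD yin yv)).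
  have yw_in : oball zb (mu + delta%:E)%E (y - w).
    apply: oball_sym; rewrite /oball /= distB; apply: oball_sym.
    apply: (oballD _ yin); rewrite /oball /= ![zb + _]addrC Y_inv.
    by rewrite metric_sym in w_in *.
  (* By invariance [y - w] is as far from [z] as [y] is from [v], so [z] witnesses the distance
     condition in (i). *)
  have z_near : oball (y - w) r z by rewrite /oball /= distB zwE.
  (* The infimum defining the distance may not be attained; [kappa < k] and [y != v] leave room for
     an actual point. *)
  have [u' /= Fu' uu'] : exists2 u', F u' (y - w) & mdist u u' < k * mdist y v.
    suff /ereal_inf_lt[_ [u' Fu' <-]] :
        (dist_set u (svinv F (y - w)%R) < (k * mdist y v)%:E)%E.
      by rewrite lte_fin; exists u'.
    apply: (@le_lt_trans _ _ (kappa * mdist y v)%:E).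
      apply: (le_trans (regF u (y - w) _)).
        split=> //=; apply: le_lt_trans z_near; apply: dist_set_le.
        by split=> //; apply: oballD yw_in _; rewrite /oball /= distB zwE.
      rewrite EFinM; apply: lee_wpmul2l; first by rewrite lee_fin ltW.
      by rewrite -zwE -distB; apply: dist_set_le.
    by rewrite lte_fin ltr_pM2r.
  (* The bound is kept general in [t]: [t = 0] places [u'] in the ball before the Aubin property is
     applied there, and the new residual is inserted afterwards. *)
  have u'_alpha (t : R) : t <= k * l * mdist y v ->
      mdist u u' + hkappa * t <= hkappa * mdist y v.
    move=> t_le; rewrite -[X in _ <= X * _]kE mulrDl lerD ?(ltW uu')//.
    by rewrite -mulrA ler_wpM2l// ltW.
  have xbu' (t : R) : t <= k * l * mdist y v ->
      ((mdist xb u' + hkappa * t)%:E < alpha)%E.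
    move=> /u'_alpha h; apply: le_lt_trans uv_alpha.
    rewrite lee_fin; have := metric_triangle xb u u'; lra.
  have u'_in : oball xb alpha u'.
    have := xbu' 0; rewrite mulr0 addr0; apply.
    by rewrite mulr_ge0 ?mdist_ge0// ltW// mulr_gt0.
  have [w' Gw' [b b_le wE]] := aubG u u' u_in u'_in w (conj Gw w_in).
  (* Since [w = w' + b], the new point is [y - b], at distance [mdist 0 b] from [y]. *)
  have yv' : mdist y (y - w + w') <= k * l * mdist y v.
    rewrite -wE opprD addrA addrAC subrK metric_sym distB.
    rewrite [y + b]addrC -[X in mdist X _]add0r Y_inv.
    apply: le_trans (_ : l * mdist u u' <= _); first by rewrite -lee_fin.
    by rewrite mulrAC [leRHS]mulrC ler_wpM2l ?ltW.
  exists u', (y - w + w'); split=> //; last exact: u'_alpha.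
  split=> /=; [by exists (y - w) => //; exists w'|exact: xbu'|].
  apply: le_lt_trans yv; rewrite lee_fin (le_trans yv')//.
  by rewrite ler_piMl ?mdist_ge0 ?ltW.
have solve v : H x v -> oball y r v ->
    (dist_set x (svinv H y) <= (hkappa * mdist y v)%:E)%E.
  move=> Hxv yv.
  have kl01 : 0 <= k * l < 1 by rewrite kl_lt1 mulr_ge0 ?ltW.
  have Pxv : P (x, v).
    split=> //=; rewrite EFinD EFinM; apply: lteD => //.
    by rewrite lte_pmul2l.
  have [x' clx' xx'] := metric_descent hkappa_gt0 kl01 step Pxv.
  have PH : P `<=` svgraph H by move=> p [].
  have Hx' : svgraph H (x', y).
    by rewrite ((closure_id _).1 clH); exact: closureS clx'.
  by apply: le_trans (dist_set_le x Hx') _; rewrite lee_fin.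
rewrite -lee_pdivrMl//; apply: le_ereal_inf_tmp => _ [v Hv <-].
rewrite lee_pdivrMl// -EFinM.
(* If [v] is not within [r] of [y], then [solve] does not apply to it, but [dr] yields a closer [v0]
   with a stronger bound. *)
have [yv|ry] := ltP (mdist y v)%:E r; first exact: solve.
have /ereal_inf_lt[_ [v0 Hv0 <-] yv0] := dr.
apply: (le_trans (solve v0 Hv0 yv0)); rewrite lee_fin ler_wpM2l ?ltW//.
by rewrite -lte_fin; apply: lt_le_trans ry.
Qed.
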